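(* Let $p$ be a prime, let $\{g_n\}$ be a sequence of $p$-adic Möbius maps, let $z_1,z_2,z_3\in\mathbb{P}^1(\mathbb{C}_p)$ be three distinct points, and suppose $g_n(z_j)\to w_j$ for $j=1,2,3$, where $w_1,w_2,w_3\in\mathbb{P}^1(\mathbb{C}_p)$ are also three distinct points. Then the sequence $\{g_n\}$ converges uniformly (on $\mathbb{P}^1(\mathbb{C}_p)$, with respect to the chordal metric) to a $p$-adic Möbius map $g$, where $g(z_j)=w_j$ for $j=1,2,3$.
   Context: $\mathbb{C}_p$ is the completion of the algebraic closure of $\mathbb{Q}_p$. A $p$-adic Möbius map is an element of $\mathrm{PSL}(2,\mathbb{C}_p)=\mathrm{SL}(2,\mathbb{C}_p)/\{\pm I\}$, acting on $\mathbb{P}^1(\mathbb{C}_p)=\mathbb{C}_p\cup\{\infty\}$ by $z\mapsto\frac{az+b}{cz+d}$, $ad-bc=1$. Chordal metric: $\rho_v(z,w)=\frac{|z-w|}{\max\{1,|z|\}\max\{1,|w|\}}$ for $z,w\in\mathbb{C}_p$, $\rho_v(\infty,w)=\rho_v(w,\infty)=\frac1{\max\{1,|w|\}}$ for $w\in\mathbb{C}_p$, $\rho_v(\infty,\infty)=0$. Convergence of points is in this metric, and uniform convergence $g_n\to g$ means $\sup_{z\in\mathbb{P}^1(\mathbb{C}_p)}\rho_v(g_n(z),g(z))\to0$. *)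

(* Defs.v *)
From HB Require Import structures.
From mathcomp Require Import all_boot all_order all_algebra.
From mathcomp Require Import all_classical all_reals all_analysis.

Set Implicit Arguments.
Unset Strict Implicit.
Unset Printing Implicit Defensive.

Import Order.TTheory GRing.Theory Num.Theory.
Import numFieldNormedType.Exports.

Local Open Scope classical_set_scope.
Local Open Scope quotient_scope.
Local Open Scope ring_scope.

Record nonarchimedean_abs (R : realType) (K : fieldType) (v : K -> R) : Prop :=
  NonarchimedeanAbs {
    nabs_ge0 : forall x, 0 <= v x;
    nabs_eq0 : forall x, v x = 0 <-> x = 0;
    nabsM : forall x y, v (x * y) = v x * v y;
    nabsD : forall x y, v (x + y) <= Num.max (v x) (v y) }.

Definition abs_complete (R : realType) (K : fieldType) (v : K -> R) : Prop :=
  forall u : nat -> K,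
    (forall e : R, 0 < e -> exists N : nat, forall m n : nat,
       (N <= m)%N -> (N <= n)%N -> v (u m - u n) < e) ->
    exists l : K, v (u n - l) @[n --> \oo] --> (0 : R).

                                                                
Record is_completion (R : realType) (F K : fieldType) (vF : F -> R) (v : K -> R)
    (i : {rmorphism F -> K}) : Prop := IsCompletion {
  completion_isometric : forall x, v (i x) = vF x;
  completion_dense : forall (x : K) (e : R), 0 < e -> exists y, v (x - i y) < e;
  completion_complete : abs_complete v }.

                                                           
Record is_algebraic_closure (F L : fieldType) (i : {rmorphism F -> L}) : Prop :=
  IsAlgebraicClosure {
    algclosure_algebraic : forall x, algebraicOver i x;
    algclosure_closed : GRing.closed_field_axiom L }.

                                                                              
              
Definition padic_abs (R : realType) (p : nat) (x : rat) : R :=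
  if x == 0 then 0
  else p%:R ^ ((logn p `|denq x|)%:Z - (logn p `|numq x|)%:Z).

                                                                      
                                                                           
                                                                            
                                                  
Record padicComplex (R : realType) (p : nat) := PadicComplex {
  Qp : fieldType;
  Qp_abs : Qp -> R;
  Qp_abs_nonarchimedean : nonarchimedean_abs Qp_abs;
  rat_to_Qp : {rmorphism rat -> Qp};
  Qp_completion : is_completion (@padic_abs R p) Qp_abs rat_to_Qp;
  Qpbar : fieldType;
  Qpbar_abs : Qpbar -> R;
  Qpbar_abs_nonarchimedean : nonarchimedean_abs Qpbar_abs;
  Qp_to_Qpbar : {rmorphism Qp -> Qpbar};
  Qpbar_algebraic_closure : is_algebraic_closure Qp_to_Qpbar;
  Qpbar_abs_extends : forall x, Qpbar_abs (Qp_to_Qpbar x) = Qp_abs x;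
  Cp :> fieldType;
  Cp_abs : Cp -> R;
  Cp_abs_nonarchimedean : nonarchimedean_abs Cp_abs;
  Qpbar_to_Cp : {rmorphism Qpbar -> Cp};
  Cp_completion : is_completion Qpbar_abs Cp_abs Qpbar_to_Cp }.

Arguments Cp_abs {R p} K _ : rename.

                                                            
Definition P1 (K : fieldType) : Type := option K.

Definition SL2 (K : fieldType) : Type := {A : 'M[K]_2 | \det A == 1}.

Definition SL2_eqpm (K : fieldType) : rel (SL2 K) :=
  fun A B => (val A == val B) || (val A == - val B).

Lemma SL2_eqpm_refl (K : fieldType) : reflexive (@SL2_eqpm K).
Proof. by move=> A; rewrite /SL2_eqpm eqxx. Qed.

Lemma SL2_eqpm_sym (K : fieldType) : symmetric (@SL2_eqpm K).
Proof.
by move=> A B; rewrite /SL2_eqpm eq_sym -eqr_oppLR [- val A == _]eq_sym.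
Qed.

Lemma SL2_eqpm_trans (K : fieldType) : transitive (@SL2_eqpm K).
Proof.
move=> B A C; rewrite /SL2_eqpm => /orP[]/eqP-> /orP[]/eqP->;
by rewrite ?opprK eqxx ?orbT.
Qed.

Canonical SL2_eqpm_equiv (K : fieldType) :=
  EquivRel (@SL2_eqpm K) (@SL2_eqpm_refl K) (@SL2_eqpm_sym K)
    (@SL2_eqpm_trans K).

                      
Definition PSL2 (K : fieldType) := {eq_quot (@SL2_eqpm K)}.

Definition SL2_act (K : fieldType) (A : SL2 K) (z : P1 K) : P1 K :=
  let a := val A 0 0 in let b := val A 0 1 in
  let c := val A 1 0 in let d := val A 1 1 in
  match z with
  | Some x => if c * x + d == 0 then None else Some ((a * x + b) / (c * x + d))
  | None => if c == 0 then None else Some (a / c)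
  end.

Definition mobius (K : fieldType) (g : PSL2 K) : P1 K -> P1 K :=
  SL2_act (repr g).

Lemma SL2_act_eqpm (K : fieldType) (A B : SL2 K) :
  SL2_eqpm A B -> SL2_act A =1 SL2_act B.
Proof.
rewrite /SL2_eqpm => /orP[/eqP/val_inj->//|/eqP AB] [x|]; rewrite /SL2_act AB !mxE.
  by rewrite !mulNr -!opprD oppr_eq0 invrN mulrNN.
by rewrite oppr_eq0 invrN mulrNN.
Qed.

                                                       
Lemma mobius_pi (K : fieldType) (A : SL2 K) :
  mobius (\pi_(PSL2 K) A) =1 SL2_act A.
Proof.
apply: SL2_act_eqpm.
by have /eqmodP := reprK (\pi_(PSL2 K) A).
Qed.

Definition chordal (R : realType) (K : fieldType) (v : K -> R) (z w : P1 K) : R :=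
  match z, w with
  | Some x, Some y => v (x - y) / (Num.max 1 (v x) * Num.max 1 (v y))
  | Some x, None | None, Some x => (Num.max 1 (v x))^-1
  | None, None => 0
  end.

Definition P1_cvg (R : realType) (K : fieldType) (v : K -> R)
    (u : nat -> P1 K) (w : P1 K) : Prop :=
  chordal v (u n) w @[n --> \oo] --> (0 : R).

                                                                       
Definition P1_unif_cvg (R : realType) (K : fieldType) (v : K -> R)
    (f : nat -> P1 K -> P1 K) (h : P1 K -> P1 K) : Prop :=
  ereal_sup [set (chordal v (f n z) (h z))%:E | z in [set: P1 K]]
    @[n --> \oo] --> (0%E : \bar R).

(* Main.v *)
Require Import Defs.
From mathcomp Require Import all_boot all_order all_algebra.
From mathcomp Require Import all_classical all_reals all_analysis.
From mathcomp Require Import ring.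

Set Implicit Arguments.
Unset Strict Implicit.
Unset Printing Implicit Defensive.

Import Order.TTheory GRing.Theory Num.Theory.
Import numFieldNormedType.Exports.

Local Open Scope classical_set_scope.
Local Open Scope ring_scope.

(** A point of the projective line has homogeneous coordinates [coord z] of
sup norm 1, and for these the chordal distance is the absolute value of a
determinant: the [wedge] of the two coordinate vectors ([chordalE]).  A matrix
of SL2 preserves wedges, so it changes the distance of [z] and [w] exactly by
the factor [1 / (stretch A z * stretch A w)] ([chordal_act]), where
[stretch A z] is the norm of [A *m coord z].  Everything follows from this and
from the ultrametric inequality.

Boundedness.  The coordinate vectors of two distinct points form a basis, so
a matrix of large norm has large stretch at one of them at least; hence it has
large stretch at two of the three points [z_j], and brings these two close
together.  The limits [w_j] are distinct, so the representatives [A_n] of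
[g_n] in SL2 have bounded norm from some rank on ([SL2_eventually_bounded]).

Cauchy property.  For [A] and [B] in SL2, the function
[q X = wedge (A X) (B X)] is a binary quadratic form, hence it is determined
by its values at three distinct points, by Lagrange interpolation
([wedge_lagrange]).  If [A] and [B] are bounded and move each [z_j] to nearly
the same point, these values are small, so all coefficients of [q] are small.
They are the off-diagonal entries and the difference of the diagonal entries
of [C = B^-1 A]; since [\det C = 1], the square of the first entry is close to
1, thus [C] is close to 1 or to -1, and [A] to [B] or to [-B] ([SL2_close]).

Limit.  As 2 is not 0 in the field, matrices of norm at least 1 that are close
to a fixed one up to sign have a consistent choice of sign
([SL2_eqpm_Cauchy]), and completeness yields a limit matrix [T].  It has
determinant 1, being a limit of matrices of determinant 1, so it defines an
element of PSL2.  Finally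
[chordal (A z) (B z) <= mxnorm A * mxnorm (A - B)] for all [z]
([chordal_le_mxnorm]), so convergence of matrices implies uniform convergence
of the maps; the values at [z_j] are then forced by uniqueness of limits. *)

Section NonarchimedeanField.
Context (R : realType) (K : fieldType) (v : K -> R).
Context (hv : nonarchimedean_abs v).

(** * Nonarchimedean absolute values *)

Lemma nabs0 : v 0 = 0.
Proof. by apply/(nabs_eq0 hv). Qed.

Lemma nabs_gt0 x : (0 < v x) = (x != 0).
Proof.
rewrite lt0r (nabs_ge0 hv) andbT; congr (~~ _).
by apply/eqP/eqP => /(nabs_eq0 hv).
Qed.

Lemma nabs1 : v 1 = 1.
Proof.
have v1_neq0 : v 1 != 0 by rewrite gt_eqF// nabs_gt0 oner_neq0.
by apply: (mulfI v1_neq0); rewrite -(nabsM hv) !mulr1.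
Qed.

Lemma nabsN x : v (- x) = v x.
Proof.
suff vN1 : v (-1) = 1 by rewrite -mulN1r (nabsM hv) vN1 mul1r.
apply/eqP; rewrite -(@pexpr_eq1 _ _ 2) ?(nabs_ge0 hv)//.
by rewrite expr2 -(nabsM hv) mulrNN mulr1 nabs1.
Qed.

Lemma nabsV x : v x^-1 = (v x)^-1.
Proof.
have [->|x0] := eqVneq x 0; first by rewrite !(invr0, nabs0).
apply: (mulfI (lt0r_neq0 (_ : 0 < v x))); first by rewrite nabs_gt0.
by rewrite -(nabsM hv) !divff ?nabs1 // gt_eqF// nabs_gt0.
Qed.

Lemma nabsD_le x y c : v x <= c -> v y <= c -> v (x + y) <= c.
Proof. by move=> xc yc; rewrite (le_trans (nabsD hv x y))// ge_max xc yc. Qed.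

Lemma nabsB_le x y c : v x <= c -> v y <= c -> v (x - y) <= c.
Proof. by move=> xc yc; rewrite nabsD_le// nabsN. Qed.

Lemma nabsM_le x y c d : v x <= c -> v y <= d -> v (x * y) <= c * d.
Proof. by move=> xc yd; rewrite (nabsM hv) ler_pM// (nabs_ge0 hv). Qed.

Lemma nabs_sum_le (I : finType) (F : I -> K) c :
  0 <= c -> (forall i, v (F i) <= c) -> v (\sum_i F i) <= c.
Proof.
move=> c0 Fc; apply: (big_ind (fun x => v x <= c)) => [|x y|//].
  by rewrite nabs0.
exact: nabsD_le.
Qed.

(** * Sup norm of matrices *)

Definition mxnorm m n (A : 'M[K]_(m, n)) : R :=
  \big[Num.max/0]_(ij : 'I_m * 'I_n) v (A ij.1 ij.2).

Lemma mxnorm_le m n (A : 'M[K]_(m, n)) c :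
  0 <= c -> (forall i j, v (A i j) <= c) -> mxnorm A <= c.
Proof. by move=> c0 Ac; apply: bigmax_le. Qed.

Lemma le_mxnorm m n (A : 'M[K]_(m, n)) i j : v (A i j) <= mxnorm A.
Proof. exact: (le_bigmax _ (fun ij => v (A ij.1 ij.2)) (i, j)). Qed.

Lemma mxnorm_ge0 m n (A : 'M[K]_(m, n)) : 0 <= mxnorm A.
Proof. exact: bigmax_ge_id. Qed.
Hint Resolve mxnorm_ge0 : core.

Lemma mxnormD_le m n (A B : 'M[K]_(m, n)) c :
  mxnorm A <= c -> mxnorm B <= c -> mxnorm (A + B) <= c.
Proof.
move=> Ac Bc; apply: mxnorm_le => [|i j]; first exact: le_trans Ac.
by rewrite mxE nabsD_le// (le_trans (le_mxnorm _ _ _)).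
Qed.

Lemma mxnormZ m n a (A : 'M[K]_(m, n)) : mxnorm (a *: A) = v a * mxnorm A.
Proof.
have ub b (B : 'M[K]_(m, n)) : mxnorm (b *: B) <= v b * mxnorm B.
  apply: mxnorm_le => [|i j]; first by rewrite mulr_ge0// (nabs_ge0 hv).
  by rewrite mxE nabsM_le// le_mxnorm.
apply/le_anti; rewrite ub/=.
have [->|a0] := eqVneq a 0; first by rewrite nabs0 mul0r.
by rewrite -ler_pdivlMl ?nabs_gt0// -nabsV -{1}[A](scalerK a0) ub.
Qed.

Lemma mxnormN m n (A : 'M[K]_(m, n)) : mxnorm (- A) = mxnorm A.
Proof. by rewrite -scaleN1r mxnormZ nabsN nabs1 mul1r. Qed.

(** For a nonarchimedean absolute value the sup norm itself is
submultiplicative, without a factor for the size of the matrices. *)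
Lemma mxnormM m n k (A : 'M[K]_(m, n)) (B : 'M[K]_(n, k)) :
  mxnorm (A *m B) <= mxnorm A * mxnorm B.
Proof.
have AB0 : 0 <= mxnorm A * mxnorm B by rewrite mulr_ge0.
apply: mxnorm_le => // i j; rewrite mxE nabs_sum_le// => l.
by rewrite nabsM_le// le_mxnorm.
Qed.

(** * Two by two matrices and the wedge of plane vectors *)

Lemma mulmx2E m n (A : 'M[K]_(m, 2)) (B : 'M[K]_(2, n)) i j :
  (A *m B) i j = A i 0 * B 0 j + A i 1 * B 1 j.
Proof.
rewrite mxE !big_ord_recl big_ord0 addr0.
by congr (_ * _ + A i _ * B _ j); apply/val_inj.
Qed.

Lemma det_mx22 (A : 'M[K]_2) : \det A = A 0 0 * A 1 1 - A 0 1 * A 1 0.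
Proof.
rewrite (expand_det_row _ 0) !big_ord_recl big_ord0 addr0 /cofactor !det_mx11.
rewrite !mxE /= expr0 expr1 mul1r mulN1r mulrN.
by congr (_ * A _ _ - A _ _ * A _ _); apply/val_inj.
Qed.

Definition wedge (X Y : 'cV[K]_2) : K := X 0 0 * Y 1 0 - X 1 0 * Y 0 0.

Lemma wedge_mulmx (A : 'M[K]_2) X Y :
  wedge (A *m X) (A *m Y) = \det A * wedge X Y.
Proof. by rewrite /wedge det_mx22 !mulmx2E; ring. Qed.

Lemma wedgeZ a b X Y : wedge (a *: X) (b *: Y) = a * b * wedge X Y.
Proof. by rewrite /wedge !mxE; ring. Qed.

Lemma wedge_le X Y : v (wedge X Y) <= mxnorm X * mxnorm Y.
Proof. by apply: nabsB_le; apply: nabsM_le; apply: le_mxnorm. Qed.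

Lemma ord2_ind (P : 'I_2 -> Prop) : P 0 -> P 1 -> forall i, P i.
Proof.
move=> P0 P1 [[|[|i]]// hi].
- by rewrite (_ : Ordinal hi = 0)//; exact/val_inj.
- by rewrite (_ : Ordinal hi = 1)//; exact/val_inj.
Qed.

(** * Normalized homogeneous coordinates *)

(** A scalar of the field whose absolute value is [max 1 |x|]: dividing the
vector (x, 1) by it gives a vector of norm exactly 1. *)
Definition denom (x : K) : K := if v x <= 1 then 1 else x.

Lemma nabs_denom x : v (denom x) = Num.max 1 (v x).
Proof. by rewrite /denom; case: (leP (v x)); rewrite ?nabs1. Qed.

Lemma denom_neq0 x : denom x != 0.
Proof. by rewrite -nabs_gt0 nabs_denom lt_max ltr01. Qed.

Definition coord (z : P1 K) : 'cV[K]_2 :=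
  if z is Some x then (denom x)^-1 *: (\col_i if i == 0 then x else 1)
  else \col_i if i == 0 then 1 else 0.

Lemma coord_norm z : mxnorm (coord z) = 1.
Proof.
apply/le_anti/andP; split.
  apply: mxnorm_le => // + j; apply: ord2_ind; case: z => [x|];
    rewrite !mxE//= ?nabs0 ?nabs1// (nabsM hv) nabsV nabs_denom mulrC;
    rewrite ler_pdivrMr ?lt_max ?ltr01// mul1r le_max ?lexx ?orbT// nabs1 lexx//.
case: z => [x|] /=; last by rewrite (le_trans _ (le_mxnorm _ 0 0))// mxE nabs1.
rewrite /denom; case: (leP (v x) 1) => x1.
  by apply: le_trans (le_mxnorm _ (1 : 'I_2) (0 : 'I_1)); rewrite !mxE/= mulr1 invr1 nabs1.
apply: le_trans (le_mxnorm _ (0 : 'I_2) (0 : 'I_1)); rewrite !mxE/= mulVf ?nabs1//.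
by rewrite -nabs_gt0 (lt_trans _ x1).
Qed.

(** With coordinates of norm 1 the denominators of the chordal metric, and its
special cases at infinity, disappear. *)
Lemma chordalE z w : chordal v z w = v (wedge (coord z) (coord w)).
Proof.
rewrite /chordal /wedge; case: z w => [x|] [y|]; rewrite !mxE/=.
- rewrite [X in _ = v X](_ : _ = (x - y) * ((denom x)^-1 * (denom y)^-1)); last by ring.
  by rewrite -invfM (nabsM hv) nabsV (nabsM hv) !nabs_denom.
- by rewrite !mulr1 mulr0 sub0r nabsN nabsV nabs_denom.
- by rewrite !mulr1 mul1r mul0r subr0 nabsV nabs_denom.
- by rewrite mulr0 mul0r subrr nabs0.
Qed.

Lemma chordal_ge0 z w : 0 <= chordal v z w.
Proof. by rewrite chordalE (nabs_ge0 hv). Qed.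

Lemma chordal_le1 z w : chordal v z w <= 1.
Proof. by rewrite chordalE (le_trans (wedge_le _ _))// !coord_norm mulr1. Qed.

Lemma chordalC z w : chordal v z w = chordal v w z.
Proof. by rewrite !chordalE -nabsN; congr v; rewrite /wedge; ring. Qed.

Lemma chordal_eq0 z w : chordal v z w = 0 -> z = w.
Proof.
case: z w => [x|] [y|] //=.
- have d0 t : (Num.max 1 (v t)) != 0 by rewrite gt_eqF// lt_max ltr01.
  move/eqP; rewrite mulf_eq0 invr_eq0 mulf_eq0 !(negPf (d0 _)) !orbF.
  by move=> /eqP/(nabs_eq0 hv)/eqP; rewrite subr_eq0 => /eqP->.
- by move/eqP; rewrite invr_eq0 gt_eqF// lt_max ltr01.
- by move/eqP; rewrite invr_eq0 gt_eqF// lt_max ltr01.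
Qed.

Lemma chordal_gt0 z w : z <> w -> 0 < chordal v z w.
Proof. by move=> zw; rewrite lt0r chordal_ge0 andbT; apply/eqP => /chordal_eq0. Qed.

(** Cramer's rule in the plane.  It yields both the ultrametric inequality for
[chordal] and the fact that a matrix is controlled by its values at two
distinct points. *)
Lemma wedge_expand X Y Z : wedge X Y *: Z = wedge Z Y *: X + wedge X Z *: Y.
Proof.
by apply/matrixP => + j; rewrite ord1; apply: ord2_ind; rewrite /wedge !mxE; ring.
Qed.

Lemma chordal_ultra z w c y :
  chordal v z y <= c -> chordal v y w <= c -> chordal v z w <= c.
Proof.
move=> zy yw; rewrite chordalE -[v _]mulr1 -(coord_norm y) -mxnormZ wedge_expand.
by apply: mxnormD_le; rewrite mxnormZ coord_norm mulr1 -chordalE.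
Qed.

(** * Action of SL2 and distortion of the chordal metric *)

Definition stretch (A : 'M[K]_2) (z : P1 K) : R := mxnorm (A *m coord z).

Lemma stretch_ge0 A z : 0 <= stretch A z.
Proof. exact: mxnorm_ge0. Qed.
Hint Resolve stretch_ge0 : core.

Lemma stretch_le A z : stretch A z <= mxnorm A.
Proof. by rewrite (le_trans (mxnormM _ _))// coord_norm mulr1. Qed.

(** Matrix coordinates and Moebius action agree up to a scalar, and the norm 1
of [coord] makes the stretch its absolute value. *)
Lemma mulmx_coord (A : SL2 K) z :
  exists2 c, v c = stretch (val A) z &
    val A *m coord z = c *: coord (SL2_act A z).
Proof.
suff [c Ac] : exists c, val A *m coord z = c *: coord (SL2_act A z).
  by exists c => //; rewrite /stretch Ac mxnormZ coord_norm mulr1.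
case: z => [x|] /=.
  case: ifPn => [/eqP den0|den0].
    exists ((denom x)^-1 * (val A 0 0 * x + val A 0 1)).
    apply/matrixP => + j; rewrite ord1; apply: ord2_ind; rewrite mulmx2E !mxE/=.
      by ring.
    rewrite mulr0 -[RHS](mulr0 (denom x)^-1) -den0; ring.
  set y := (_ / _); set e := denom y; have e0 : e != 0 := denom_neq0 y.
  exists ((denom x)^-1 * (val A 1 0 * x + val A 1 1) * e).
  rewrite /= -/e; clearbody e.
  apply/matrixP => + j; rewrite ord1; apply: ord2_ind; rewrite mulmx2E !mxE/=.
    by rewrite /y; field; rewrite den0 e0 denom_neq0.
  by field; rewrite e0 denom_neq0.
case: ifPn => [/eqP c0|c0].
  exists (val A 0 0); apply/matrixP => + j; rewrite ord1; apply: ord2_ind;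
    by rewrite mulmx2E !mxE/= ?c0; ring.
set y := (_ / _); set e := denom y; have e0 : e != 0 := denom_neq0 y.
exists (val A 1 0 * e); rewrite /= -/e; clearbody e.
apply/matrixP => + j; rewrite ord1; apply: ord2_ind; rewrite mulmx2E !mxE/=.
  by rewrite /y; field; rewrite c0 e0.
by field.
Qed.

Lemma wedge_act (A B : SL2 K) z w :
  v (wedge (val A *m coord z) (val B *m coord w)) =
  stretch (val A) z * stretch (val B) w * chordal v (SL2_act A z) (SL2_act B w).
Proof.
have [a <- ->] := mulmx_coord A z; have [b <- ->] := mulmx_coord B w.
by rewrite wedgeZ !(nabsM hv) -chordalE.
Qed.

Lemma det_SL2 (A : SL2 K) : \det (val A) = 1.
Proof. exact/eqP/(valP A). Qed.

(** The determinant 1 makes the numerator of the chordal distance invariant;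
only the normalization of the coordinates contributes. *)
Lemma chordal_act (A : SL2 K) z w :
  chordal v z w =
  stretch (val A) z * stretch (val A) w * chordal v (SL2_act A z) (SL2_act A w).
Proof. by rewrite -wedge_act wedge_mulmx det_SL2 mul1r chordalE. Qed.

Lemma mxnorm_adj (A : 'M[K]_2) : mxnorm (\adj A) <= mxnorm A.
Proof.
apply: mxnorm_le => // i j; rewrite mxE /cofactor det_mx11 (nabsM hv).
rewrite (_ : v (_ ^+ _) = 1) ?mul1r; last first.
  by elim: (j + i)%N => [|k IH]; rewrite ?nabs1// exprS (nabsM hv) IH nabsN nabs1 mulr1.
by rewrite !mxE le_mxnorm.
Qed.

Lemma mxnorm_ge1 (A : 'M[K]_2) : \det A = 1 -> 1 <= mxnorm A.
Proof.
move=> A1; rewrite -(@ler_pXn2r _ 2) ?nnegrE// expr1n -nabs1 -A1 det_mx22 expr2.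
by apply: nabsB_le; apply: nabsM_le; apply: le_mxnorm.
Qed.

(** The inverse of [A] is its adjugate, which has the same norm, so [A] cannot
shrink a vector by more than the factor [mxnorm A]. *)
Lemma stretch_ge (A : 'M[K]_2) z :
  \det A = 1 -> 1 <= mxnorm A * stretch A z.
Proof.
move=> A1; rewrite -(coord_norm z) -[coord z in leLHS]mul1mx -A1 -mul_adj_mx -mulmxA.
by rewrite (le_trans (mxnormM _ _))// ler_wpM2r// mxnorm_adj.
Qed.

(** Coordinates of two points expand every vector with coefficients at most
[1 / chordal v z1 z2], so the values of [A] at these points bound [A]. *)
Lemma mxnorm_le_stretch A z1 z2 :
  chordal v z1 z2 * mxnorm A <= Num.max (stretch A z1) (stretch A z2).
Proof.
rewrite chordalE -mxnormZ; apply: mxnorm_le => [|i j]; first by rewrite le_max mxnorm_ge0.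
set Z1 := coord z1; set Z2 := coord z2; set E : 'cV[K]_2 := delta_mx j 0.
have E1 : mxnorm E <= 1.
  by apply: mxnorm_le => // k l; rewrite mxE; case: (_ && _); rewrite ?nabs0 ?nabs1 ?ler01.
rewrite (_ : (_ *: A) i j = (A *m (wedge Z1 Z2 *: E)) i 0); last first.
  by rewrite -scalemxAr -colE !mxE.
rewrite (le_trans (le_mxnorm _ _ _))// wedge_expand mulmxDr -!scalemxAr.
have wl z w : mxnorm z <= 1 -> mxnorm w <= 1 -> v (wedge z w) <= 1.
  by move=> z1' w1'; rewrite (le_trans (wedge_le _ _))// mulr_ile1.
apply: mxnormD_le; rewrite mxnormZ le_max; apply/orP; [left|right];
  by rewrite ler_piMl// wl// coord_norm.
Qed.

(** * Matrices that keep three points apart are bounded *)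

(** Among three points two must have stretch at least [d * mxnorm A], by
[mxnorm_le_stretch] applied to each pair; [chordal_act] for these two points
then bounds the square of this quantity. *)
Lemma SL2_norm_bound (A : SL2 K) z1 z2 z3 d eta : 0 <= d -> 0 <= eta ->
    d <= chordal v z1 z2 -> d <= chordal v z1 z3 -> d <= chordal v z2 z3 ->
    eta <= chordal v (SL2_act A z1) (SL2_act A z2) ->
    eta <= chordal v (SL2_act A z1) (SL2_act A z3) ->
    eta <= chordal v (SL2_act A z2) (SL2_act A z3) ->
  (d * mxnorm (val A)) ^+ 2 * eta <= 1.
Proof.
move=> d0 eta0 d12 d13 d23 e12 e13 e23.
set T := d * _; have T0 : 0 <= T by rewrite mulr_ge0.
have large z w : d <= chordal v z w ->
    T <= Num.max (stretch (val A) z) (stretch (val A) w).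
  by move=> dzw; rewrite (le_trans _ (mxnorm_le_stretch _ _ _))// ler_wpM2r.
have both z w : eta <= chordal v (SL2_act A z) (SL2_act A w) ->
    T <= stretch (val A) z -> T <= stretch (val A) w -> T ^+ 2 * eta <= 1.
  move=> ezw Tz Tw; rewrite (le_trans _ (chordal_le1 z w))// (chordal_act A).
  by rewrite ler_pM ?exprn_ge0// expr2 ler_pM.
move: (large _ _ d12) (large _ _ d13) (large _ _ d23); rewrite !le_max.
by move=> /orP[] ? /orP[] ? /orP[] ?;
  (exact: (both z1 z2)) || (exact: (both z1 z3)) || (exact: (both z2 z3)).
Qed.

(** * Matrices that agree approximately at three points *)

(** Lagrange interpolation: both sides are quadratic forms in [X] that agree at
the three pairwise independent vectors [Z1], [Z2], [Z3]. *)
Lemma wedge_lagrange (A B : 'M[K]_2) X Z1 Z2 Z3 :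
  let q Y := wedge (A *m Y) (B *m Y) in
  wedge Z1 Z2 * wedge Z1 Z3 * wedge Z2 Z3 * q X =
    q Z1 * (wedge X Z2 * wedge X Z3 * wedge Z2 Z3)
    - q Z2 * (wedge X Z1 * wedge X Z3 * wedge Z1 Z3)
    + q Z3 * (wedge X Z1 * wedge X Z2 * wedge Z1 Z2).
Proof. by rewrite /= /wedge !mulmx2E; ring. Qed.

Lemma wedge_small (A B : SL2 K) z1 z2 z3 M e X :
    mxnorm (val A) <= M -> mxnorm (val B) <= M -> mxnorm X <= 1 ->
    chordal v (SL2_act A z1) (SL2_act B z1) <= e ->
    chordal v (SL2_act A z2) (SL2_act B z2) <= e ->
    chordal v (SL2_act A z3) (SL2_act B z3) <= e ->
  chordal v z1 z2 * chordal v z1 z3 * chordal v z2 z3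
    * v (wedge (val A *m X) (val B *m X)) <= M * M * e.
Proof.
move=> AM BM X1 e1 e2 e3.
have q_le z : chordal v (SL2_act A z) (SL2_act B z) <= e ->
    v (wedge (val A *m coord z) (val B *m coord z)) <= M * M * e.
  move=> ez; rewrite wedge_act ler_pM ?mulr_ge0 ?chordal_ge0//.
  by rewrite ler_pM// (le_trans (stretch_le _ _)).
have w1 Y Z : mxnorm Y <= 1 -> mxnorm Z <= 1 -> v (wedge Y Z) <= 1.
  by move=> Y1 Z1; rewrite (le_trans (wedge_le _ _))// mulr_ile1.
have c1 z : mxnorm (coord z) <= 1 by rewrite coord_norm.
have w3 Y Y' Z Z' T T' : mxnorm Y <= 1 -> mxnorm Z <= 1 -> mxnorm T <= 1 ->
    mxnorm Y' <= 1 -> mxnorm Z' <= 1 -> mxnorm T' <= 1 ->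
    v (wedge Y Y' * wedge Z Z' * wedge T T') <= 1.
  by move=> *; rewrite !(nabsM hv) !mulr_ile1 ?mulr_ge0 ?w1// (nabs_ge0 hv).
rewrite !chordalE -!(nabsM hv) wedge_lagrange -(mulr1 (M * M * e)).
apply: nabsD_le; first apply: nabsB_le; apply: nabsM_le; by [apply: q_le | apply: w3].
Qed.

(** [(C00 - 1) (C00 + 1) = C00 (C00 - C11) + C01 C10] because [\det C = 1]; a
product of at most [t ^+ 2] has a factor of at most [t], and this factor
selects the sign. *)
Lemma SL2_near_pm1 (C : 'M[K]_2) L t :
    \det C = 1 -> mxnorm C <= L -> 0 < t <= 1 ->
    L * v (C 0 1) <= t ^+ 2 -> L * v (C 1 0) <= t ^+ 2 ->
    L * v (C 0 0 - C 1 1) <= t ^+ 2 ->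
  mxnorm (C - 1%:M) <= t \/ mxnorm (C + 1%:M) <= t.
Proof.
move=> C1 CL /andP[t0 t1] c01 c10 c00.
have L1 : 1 <= L := le_trans (mxnorm_ge1 C1) CL.
have le_t x : L * v x <= t ^+ 2 -> v x <= t.
  move=> Lx; rewrite (@le_trans _ _ (L * v x))// ?ler_peMl ?(nabs_ge0 hv)//.
  by rewrite (le_trans Lx)// expr2 ler_piMr// ltW.
have c00_sq : v (C 0 0 - 1) * v (C 0 0 + 1) <= t ^+ 2.
  rewrite -(nabsM hv) (_ : _ * _ = C 0 0 * (C 0 0 - C 1 1) + C 0 1 * C 1 0).
    apply: nabsD_le; rewrite (nabsM hv); [apply: le_trans c00|apply: le_trans c10];
      by rewrite ler_wpM2r ?(nabs_ge0 hv)// (le_trans (le_mxnorm _ _ _)).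
  transitivity (C 0 0 * C 0 0 - 1); first by ring.
  by rewrite -C1 det_mx22; ring.
have close a : v (C 0 0 - a) <= t -> mxnorm (C - a%:M) <= t.
  move=> ha; apply: mxnorm_le; first exact: ltW.
  apply: ord2_ind; apply: ord2_ind; rewrite !mxE/= ?mulr1n ?mulr0n ?subr0 //;
    [exact: le_t|exact: le_t|].
  rewrite (_ : _ - a = (C 0 0 - a) - (C 0 0 - C 1 1)); last by ring.
  by rewrite nabsB_le// le_t.
have [lt1|] := leP (v (C 0 0 - 1)) t; first by left; apply: close.
have [lt1 _|h1 h2] := leP (v (C 0 0 + 1)) t.
  right; have := close (-1); rewrite opprK => /(_ lt1).
  by rewrite raddfN opprK.
by move: c00_sq; rewrite leNgt expr2 ltr_pM// ltW.
Qed.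

(** The form [wedge (A X) (B X)] equals [wedge (C X) X] for [C = B^-1 A], which
has norm at most [M ^+ 2]; its coefficients are the entries that
[SL2_near_pm1] asks to be small.  One factor [M ^+ 2] of [M ^+ 4] comes from
[wedge_small], the other one is the bound [L] of [SL2_near_pm1]. *)
Lemma SL2_close (A B : SL2 K) z1 z2 z3 M e t :
    mxnorm (val A) <= M -> mxnorm (val B) <= M -> 0 < t <= 1 ->
    z1 <> z2 -> z1 <> z3 -> z2 <> z3 ->
    chordal v (SL2_act A z1) (SL2_act B z1) <= e ->
    chordal v (SL2_act A z2) (SL2_act B z2) <= e ->
    chordal v (SL2_act A z3) (SL2_act B z3) <= e ->
    M ^+ 4 * e <= chordal v z1 z2 * chordal v z1 z3 * chordal v z2 z3 * t ^+ 2 ->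
  mxnorm (val A - val B) <= M * t \/ mxnorm (val A + val B) <= M * t.
Proof.
move=> AM BM t01 z12 z13 z23 e1 e2 e3.
set D := chordal v z1 z2 * chordal v z1 z3 * chordal v z2 z3; move=> De.
have D0 : 0 < D by rewrite /D !mulr_gt0 ?chordal_gt0.
have dB := det_SL2 B.
set C := \adj (val B) *m val A.
have BC : val A = val B *m C by rewrite mulmxA mul_mx_adj dB mul1mx.
have dC : \det C = 1.
  have : \det (val B *m C) = 1 by rewrite -BC det_SL2.
  by rewrite det_mulmx dB mul1r.
have M1 : 1 <= M := le_trans (mxnorm_ge1 dB) BM.
have M0 : 0 <= M := le_trans ler01 M1.
have CM : mxnorm C <= M * M.
  rewrite (le_trans (mxnormM _ _))// ler_pM//.
  exact: le_trans (mxnorm_adj _) BM.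
have q_le X x : mxnorm X <= 1 -> wedge (C *m X) X = x -> M * M * v x <= t ^+ 2.
  move=> X1 <-; rewrite -(ler_pM2l D0); apply: le_trans De.
  have := wedge_small AM BM X1 e1 e2 e3; rewrite -/D BC -mulmxA wedge_mulmx dB mul1r => h.
  rewrite mulrCA (_ : M ^+ 4 * e = M * M * (M * M * e)); last by ring.
  by rewrite ler_wpM2l// mulr_ge0.
have X1 a b : v a <= 1 -> v b <= 1 ->
    mxnorm (\col_(i < 2) (if i == 0 then a else b)) <= 1.
  by move=> a1 b1; apply: mxnorm_le => // i j; rewrite mxE; case: ifP.
have v01 : v 0 <= 1 by rewrite nabs0.
have v11 : v 1 <= 1 by rewrite nabs1.
(* The coefficients of the form are read off at (1, 0), (0, 1) and (1, 1). *)
have c10 : M * M * v (C 1 0) <= t ^+ 2.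
  rewrite -nabsN; apply: (q_le _ _ (X1 1 0 v11 v01)).
  by rewrite /wedge !mulmx2E !mxE/=; ring.
have c01 : M * M * v (C 0 1) <= t ^+ 2.
  apply: (q_le _ _ (X1 0 1 v01 v11)).
  by rewrite /wedge !mulmx2E !mxE/=; ring.
have c11 : M * M * v (C 0 0 - C 1 1) <= t ^+ 2.
  have MM : 0 < M * M by rewrite mulr_gt0// (lt_le_trans ltr01).
  move: c10 c01; rewrite -!ler_pdivlMl// => c10 c01.
  rewrite (_ : C 0 0 - C 1 1 =
    C 0 0 + C 0 1 - (C 1 0 + C 1 1) - C 0 1 + C 1 0); last by ring.
  rewrite nabsD_le// nabsB_le// ler_pdivlMl//.
  apply: (q_le _ _ (X1 1 1 v11 v11)).
  by rewrite /wedge !mulmx2E !mxE/=; ring.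
have BCt X : mxnorm X <= t -> mxnorm (val B *m X) <= M * t.
  by move=> Xt; rewrite (le_trans (mxnormM _ _))// ler_pM.
by case: (SL2_near_pm1 dC CM t01 c01 c10 c11) => /BCt;
  rewrite (mulmxBr, mulmxDr) mulmx1 -BC; [left|right].
Qed.

(** * Limits of matrices up to sign *)

Lemma cvg0P (f : nat -> R) : (forall k, 0 <= f k) ->
  f k @[k --> \oo] --> (0 : R) <->
  forall e, 0 < e -> exists N, forall k, (N <= k)%N -> f k <= e.
Proof.
move=> f0; rewrite cvgr0Pnorm_le; split => cf e e0.
  by have [N _ fN] := cf e e0; exists N => k /fN /=; rewrite ger0_norm.
by have [N fN] := cf e e0; exists N => // k /fN /=; rewrite ger0_norm.
Qed.

Lemma mx_complete m n (U : nat -> 'M[K]_(m, n)) : abs_complete v ->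
    (forall e, 0 < e -> exists N, forall k l,
       (N <= k)%N -> (N <= l)%N -> mxnorm (U k - U l) <= e) ->
  exists B, mxnorm (U k - B) @[k --> \oo] --> (0 : R).
Proof.
move=> vcomplete cU.
have /choice[b Ub] : forall ij : 'I_m * 'I_n, exists b,
    v (U k ij.1 ij.2 - b) @[k --> \oo] --> (0 : R).
  case=> i j; apply: (vcomplete (fun k => U k i j)) => e e0.
  have [N UN] := cU _ (divr_gt0 e0 (ltr0n _ 2)); exists N => k l Nk Nl.
  apply: (@le_lt_trans _ _ (e / 2)); last by rewrite ltr_pdivrMr// ltr_pMr// ltr1n.
  by apply: le_trans (UN _ _ Nk Nl); have := le_mxnorm (U k - U l) i j; rewrite !mxE.
exists (\matrix_(i, j) b (i, j)); apply/cvg0P => // e e0.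
have [ij|N _ UN] := @filter_forall _ _
  (fun ij => [set k | v (U k ij.1 ij.2 - b ij) <= e]) (\oo) _ _.
  have /cvg0P -/(_ (fun=> nabs_ge0 hv _) e e0)[N UN] := Ub ij.
  by exists N.
exists N => k Nk; apply: mxnorm_le; first exact: ltW.
by move=> i j; rewrite !mxE; exact: UN k Nk (i, j).
Qed.

Lemma SL2_eqpm_close (A : SL2 K) B c :
    mxnorm (val A - B) <= c \/ mxnorm (val A + B) <= c ->
  exists2 S : SL2 K, SL2_eqpm A S & mxnorm (val S - B) <= c.
Proof.
case=> Ac; first by exists A; rewrite // SL2_eqpm_refl.
have dN : \det (- val A) == 1.
  have := det_SL2 A; move: (val A) => C <-.
  by rewrite !det_mx22 !mxE !mulrNN.
exists (exist _ (- val A) dN); first by rewrite /SL2_eqpm /= opprK eqxx orbT.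
by rewrite /= -opprD mxnormN.
Qed.

(** Beyond some rank [N0] every [A k] is within [|2| / 2] of [A N0] up to sign;
choose this sign.  If two chosen matrices were close to opposite ones, then
[2 *: A N0] would have norm at most [|2| / 2], whereas [A N0] has norm at
least 1. *)
Lemma SL2_eqpm_Cauchy (A : nat -> SL2 K) : 2%:R != 0 :> K ->
    (forall e, 0 < e -> exists N, forall k l, (N <= k)%N -> (N <= l)%N ->
       mxnorm (val (A k) - val (A l)) <= e \/
       mxnorm (val (A k) + val (A l)) <= e) ->
  exists2 S : nat -> SL2 K, (forall k, SL2_eqpm (A k) (S k)) &
    forall e, 0 < e -> exists N, forall k l, (N <= k)%N -> (N <= l)%N ->
      mxnorm (val (S k) - val (S l)) <= e.
Proof.
move=> two_neq0 cA; have v2 : 0 < v 2%:R by rewrite nabs_gt0.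
pose e0 := v 2%:R / 2; have e0_gt0 : 0 < e0 by rewrite divr_gt0.
have [N0 AN0] := cA e0 e0_gt0.
have /choice[S AS] : forall k, exists S : SL2 K, SL2_eqpm (A k) S /\
    ((N0 <= k)%N -> mxnorm (val S - val (A N0)) <= e0).
  move=> k; have [N0k|kN0] := leqP N0 k; last by exists (A k); rewrite SL2_eqpm_refl.
  by have [S ? ?] := SL2_eqpm_close (AN0 _ _ N0k (leqnn _)); exists S.
exists S => [k|e e_gt0]; first by have [] := AS k.
have [|N AN] := cA (Num.min e e0); first by rewrite lt_min e_gt0.
exists (maxn N0 N) => k l; rewrite !geq_max => /andP[N0k Nk] /andP[N0l Nl].
have [] : mxnorm (val (S k) - val (S l)) <= Num.min e e0 \/
          mxnorm (val (S k) + val (S l)) <= Num.min e e0.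
- have := AN _ _ Nk Nl; have [+ _] := AS k; have [+ _] := AS l.
  have flip (X Y : 'M[K]_2) : mxnorm (- X + Y) = mxnorm (X - Y).
    by rewrite -mxnormN opprD opprK.
  rewrite /SL2_eqpm => /orP[] /eqP-> /orP[] /eqP->;
    by rewrite ?opprK ?flip ?opprK; tauto.
- by rewrite le_min => /andP[].
- rewrite le_min => /andP[_ SS].
  have : v 2%:R <= e0; last by rewrite leNgt /e0 ltr_pdivrMr// ltr_pMr// ltr1n.
  have [_ /(_ N0k) Sk] := AS k; have [_ /(_ N0l) Sl] := AS l.
  apply: (@le_trans _ _ (mxnorm (2%:R *: val (A N0)))).
    by rewrite mxnormZ (ler_peMr (ltW v2)) ?mxnorm_ge1 ?det_SL2.
  rewrite (_ : _ *: _ = val (S k) + val (S l)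
    - (val (S k) - val (A N0)) - (val (S l) - val (A N0))).
    by do 2![apply: mxnormD_le; rewrite ?mxnormN//].
  by apply/matrixP => i j; rewrite !mxE; ring.
Qed.

Lemma det_close (A B : 'M[K]_2) M :
    mxnorm A <= M -> mxnorm B <= M ->
  v (\det A - \det B) <= M * mxnorm (A - B).
Proof.
move=> AM BM; have ent i j : v (A i j - B i j) <= mxnorm (A - B).
  by have := le_mxnorm (A - B) i j; rewrite !mxE.
have entA i j : v (A i j) <= M by rewrite (le_trans (le_mxnorm _ _ _)).
have entB i j : v (B i j) <= M by rewrite (le_trans (le_mxnorm _ _ _)).
rewrite !det_mx22 (_ : _ - _ = A 0 0 * (A 1 1 - B 1 1) + B 1 1 * (A 0 0 - B 0 0)
  - A 0 1 * (A 1 0 - B 1 0) - B 1 0 * (A 0 1 - B 0 1)); last by ring.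
by rewrite !nabsB_le// ?nabsD_le// nabsM_le.
Qed.

Lemma SL2_limit (S : nat -> SL2 K) B M :
    (forall k, mxnorm (val (S k)) <= M) ->
    mxnorm (val (S k) - B) @[k --> \oo] --> (0 : R) ->
  \det B = 1.
Proof.
move=> SM /cvg0P -/(_ (fun=> mxnorm_ge0 _)) SB.
have M1 : 1 <= M by rewrite (le_trans _ (SM 0))// mxnorm_ge1 ?det_SL2.
have M0 : 0 < M := lt_le_trans ltr01 M1.
have BM : mxnorm B <= M.
  have [N /(_ _ (leqnn _)) SN] := SB 1 ltr01.
  rewrite (_ : B = val (S N) - (val (S N) - B)); last by rewrite opprB addrC subrK.
  by rewrite mxnormD_le// mxnormN (le_trans SN).
apply/eqP; rewrite eq_sym -subr_eq0 -[_ == 0]negbK -nabs_gt0; apply/negP => d0.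
have [|N /(_ _ (leqnn _)) SN] := SB (v (1 - \det B) / 2 / M); first by rewrite !divr_gt0.
have := det_close (SM N) BM; rewrite det_SL2 leNgt => /negP; apply.
rewrite -ltr_pdivlMl// (le_lt_trans SN)// mulrC ltr_pM2l ?invr_gt0//.
by rewrite ltr_pdivrMr// ltr_pMr// ltr1n.
Qed.

(** [wedge (A Z) (B Z) = wedge ((A - B) Z) (B Z)], and dividing by the two
stretches costs only [mxnorm A]: the stretch of [B] cancels, that of [A] is
bounded below by [stretch_ge]. *)
Lemma chordal_le_mxnorm (A B : SL2 K) z :
  chordal v (SL2_act A z) (SL2_act B z) <= mxnorm (val A) * mxnorm (val A - val B).
Proof.
set c := chordal _ _ _.
have sB : 0 < stretch (val B) z.
  rewrite lt0r stretch_ge0 andbT; apply/eqP => s0.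
  by have := stretch_ge z (det_SL2 B); rewrite s0 mulr0 ler10.
have cA : stretch (val A) z * c <= mxnorm (val A - val B).
  rewrite -(ler_pM2l sB) mulrA [_ * stretch (val A) z]mulrC -wedge_act.
  rewrite (_ : wedge _ _ =
    wedge ((val A - val B) *m coord z) (val B *m coord z)); last first.
    by rewrite mulmxBl /wedge !mxE; ring.
  rewrite (le_trans (wedge_le _ _))// mulrC ler_wpM2l//.
  by rewrite (le_trans (mxnormM _ _))// coord_norm mulr1.
rewrite (le_trans _ (ler_wpM2l (mxnorm_ge0 _) cA))// mulrA.
by rewrite ler_peMl ?chordal_ge0// stretch_ge// det_SL2.
Qed.

(** * Convergence on the projective line *)

Lemma P1_unif_cvg_act (S : nat -> SL2 K) (T : SL2 K) M :
    (forall k, mxnorm (val (S k)) <= M) ->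
    mxnorm (val (S k) - val T) @[k --> \oo] --> (0 : R) ->
  P1_unif_cvg v (fun k => SL2_act (S k)) (SL2_act T).
Proof.
move=> SM ST; have M0 : 0 <= M := le_trans (mxnorm_ge0 _) (SM 0).
apply: (@squeeze_cvge _ _ _ _ (cst 0%E) _
  (fun k => (M * mxnorm (val (S k) - val T))%:E)).
- apply: nearW => k; apply/andP; split.
    apply: le_ereal_sup_tmp; exists (chordal v (SL2_act (S k) None) (SL2_act T None))%:E.
      by exists None.
    by rewrite lee_fin chordal_ge0.
  apply: ge_ereal_sup => _ [z _ <-]; rewrite lee_fin.
  by rewrite (le_trans (chordal_le_mxnorm _ _ _))// ler_wpM2r.
- exact: cvg_cst.
- apply: cvg_EFin; first exact: nearW.
  by rewrite -(mulr0 M); exact: cvgMr.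
Qed.

(** In an ultrametric space, moving two points by less than their distance does
not change the distance. *)
Lemma chordal_stable x y x' y' c : c < chordal v x' y' ->
  chordal v x x' <= c -> chordal v y y' <= c -> chordal v x' y' <= chordal v x y.
Proof.
move=> cxy xc yc; rewrite leNgt; apply/negP => lt_xy.
have : chordal v x' y' <= Num.max c (chordal v x y).
  apply: (@chordal_ultra _ _ _ x); first by rewrite chordalC le_max xc.
  by apply: (@chordal_ultra _ _ _ y); rewrite le_max ?lexx ?orbT// yc.
by rewrite leNgt gt_max cxy lt_xy.
Qed.


Lemma chordal_cvg3 (u1 u2 u3 : nat -> P1 K) w1 w2 w3 :
    P1_cvg v u1 w1 -> P1_cvg v u2 w2 -> P1_cvg v u3 w3 ->
  forall e, 0 < e -> exists N, forall k, (N <= k)%N ->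
    [/\ chordal v (u1 k) w1 <= e, chordal v (u2 k) w2 <= e &
        chordal v (u3 k) w3 <= e].
Proof.
move=> /cvg0P -/(_ (fun=> chordal_ge0 _ _)) c1 /cvg0P -/(_ (fun=> chordal_ge0 _ _)) c2.
move=> /cvg0P -/(_ (fun=> chordal_ge0 _ _)) c3 e e0.
have [N1 u1N] := c1 e e0; have [N2 u2N] := c2 e e0; have [N3 u3N] := c3 e e0.
exists (maxn N1 (maxn N2 N3)) => k; rewrite !geq_max => /and3P[? ? ?].
by split; [exact: u1N|exact: u2N|exact: u3N].
Qed.

Lemma P1_cvg_unique (u : nat -> P1 K) w w' :
  P1_cvg v u w -> P1_cvg v u w' -> w = w'.
Proof.
move=> uw uw'; apply/chordal_eq0/eqP; rewrite eq_le chordal_ge0 andbT.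
apply/ler_addgt0Pr => e e0; rewrite add0r. 
have [N /(_ _ (leqnn N))[uwN uw'N _]] := chordal_cvg3 uw uw' uw' e0.
by apply: (@chordal_ultra _ _ _ (u N)); rewrite // chordalC.
Qed.

Lemma P1_unif_cvg_pointwise (f : nat -> P1 K -> P1 K) h z :
  P1_unif_cvg v f h -> P1_cvg v (fun k => f k z) (h z).
Proof.
move=> fh; apply: (@fine_cvg _ _ _ _ (fun k => (chordal v (f k z) (h z))%:E)).
apply: (squeeze_cvge _ (cvg_cst 0%E) fh).
apply: nearW => k; rewrite /= lee_fin chordal_ge0/=.
by apply: ereal_sup_ubound; exists z.
Qed.

(** The product is at most each of its factors, as [chordal] is at most 1, and
so serves as a single lower bound for the three distances. *)
Definition triple_sep z1 z2 z3 :=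
  chordal v z1 z2 * chordal v z1 z3 * chordal v z2 z3.

Lemma triple_sep_gt0 z1 z2 z3 :
  z1 <> z2 -> z1 <> z3 -> z2 <> z3 -> 0 < triple_sep z1 z2 z3.
Proof. by move=> *; rewrite !mulr_gt0 ?chordal_gt0. Qed.

Lemma triple_sep_le z1 z2 z3 : [/\ triple_sep z1 z2 z3 <= chordal v z1 z2,
  triple_sep z1 z2 z3 <= chordal v z1 z3 & triple_sep z1 z2 z3 <= chordal v z2 z3].
Proof.
have c0 := chordal_ge0; have c1 := chordal_le1.
split; rewrite /triple_sep.
- by rewrite -mulrA ler_piMr// mulr_ile1.
- by rewrite mulrAC ler_piMl// mulr_ile1.
- by rewrite ler_piMl// mulr_ile1.
Qed.

Lemma SL2_eventually_bounded (A : nat -> SL2 K) z1 z2 z3 w1 w2 w3 :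
    z1 <> z2 -> z1 <> z3 -> z2 <> z3 -> w1 <> w2 -> w1 <> w3 -> w2 <> w3 ->
    P1_cvg v (fun k => SL2_act (A k) z1) w1 ->
    P1_cvg v (fun k => SL2_act (A k) z2) w2 ->
    P1_cvg v (fun k => SL2_act (A k) z3) w3 ->
  exists M N, forall k, (N <= k)%N -> mxnorm (val (A k)) <= M.
Proof.
move=> z12 z13 z23 w12 w13 w23 A1 A2 A3.
have sepz := triple_sep_gt0 z12 z13 z23; have sepw := triple_sep_gt0 w12 w13 w23.
set d := triple_sep z1 z2 z3 in sepz; set eta := triple_sep w1 w2 w3 in sepw.
have [d12 d13 d23] := triple_sep_le z1 z2 z3.
have [e12 e13 e23] := triple_sep_le w1 w2 w3.
have [N AN] := chordal_cvg3 A1 A2 A3 (divr_gt0 sepw (ltr0n _ 2)).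
have eta2 : eta / 2 < eta by rewrite ltr_pdivrMr// ltr_pMr// ltr1n.
exists (d ^+ 2 * eta)^-1, N => k /AN[c1 c2 c3].
have apart x y x' y' : chordal v (SL2_act (A k) x) x' <= eta / 2 ->
    chordal v (SL2_act (A k) y) y' <= eta / 2 -> eta <= chordal v x' y' ->
    eta <= chordal v (SL2_act (A k) x) (SL2_act (A k) y).
  move=> cx cy exy; apply: (le_trans exy).
  by apply: chordal_stable cx cy; exact: lt_le_trans exy.
(* The norm is at least 1, so it is at most its square. *)
apply: (@le_trans _ _ (mxnorm (val (A k)) ^+ 2)).
  by rewrite expr2 ler_peMl ?mxnorm_ge0// mxnorm_ge1// det_SL2.
have deta0 : 0 < d ^+ 2 * eta by rewrite mulr_gt0 ?exprn_gt0.
rewrite -[leRHS]mulr1 (ler_pdivlMl _ _ deta0) mulrAC -exprMn.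
apply: (SL2_norm_bound (ltW _) (ltW _) d12 d13 d23) => //.
- exact: (apart z1 z2 w1 w2).
- exact: (apart z1 z3 w1 w3).
- exact: (apart z2 z3 w2 w3).
Qed.

Lemma SL2_Cauchy_up_to_sign (A : nat -> SL2 K) z1 z2 z3 w1 w2 w3 M :
    z1 <> z2 -> z1 <> z3 -> z2 <> z3 ->
    P1_cvg v (fun k => SL2_act (A k) z1) w1 ->
    P1_cvg v (fun k => SL2_act (A k) z2) w2 ->
    P1_cvg v (fun k => SL2_act (A k) z3) w3 ->
    (forall k, mxnorm (val (A k)) <= M) ->
  forall e, 0 < e -> exists N, forall k l, (N <= k)%N -> (N <= l)%N ->
    mxnorm (val (A k) - val (A l)) <= e \/ mxnorm (val (A k) + val (A l)) <= e.
Proof.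
move=> z12 z13 z23 A1 A2 A3 AM e e0.
have M0 : 0 < M.
  by rewrite (lt_le_trans ltr01)// (le_trans _ (AM 0))// mxnorm_ge1// det_SL2.
have s0 := triple_sep_gt0 z12 z13 z23.
pose t := Num.min 1 (e / M).
have t0 : 0 < t by rewrite lt_min ltr01 divr_gt0.
have t1 : 0 < t <= 1 by rewrite t0 ge_min lexx.
have Mt : M * t <= e by rewrite -ler_pdivlMl// mulrC ge_min lexx orbT.
pose e' := triple_sep z1 z2 z3 * t ^+ 2 / M ^+ 4.
have e'0 : 0 < e' := divr_gt0 (mulr_gt0 s0 (exprn_gt0 2 t0)) (exprn_gt0 4 M0).
have [N AN] := chordal_cvg3 A1 A2 A3 e'0.
exists N => k l /AN[k1 k2 k3] /AN[l1 l2 l3].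
have close z w : chordal v (SL2_act (A k) z) w <= e' ->
    chordal v (SL2_act (A l) z) w <= e' ->
    chordal v (SL2_act (A k) z) (SL2_act (A l) z) <= e'.
  by move=> kz lz; apply: (chordal_ultra kz); rewrite chordalC.
have := SL2_close (AM k) (AM l) t1 z12 z13 z23
  (close _ _ k1 l1) (close _ _ k2 l2) (close _ _ k3 l3).
rewrite mulrC divfK ?expf_neq0 ?gt_eqF// => /(_ (lexx _)).
by case=> h; [left|right]; exact: le_trans Mt.
Qed.

(** This holds over every complete nonarchimedean field with [2 != 0]: the limit
of matrices of determinant 1 has determinant 1, so no square root has to be
extracted to normalize it. *)
Lemma SL2_cvg_three_points (A : nat -> SL2 K) z1 z2 z3 w1 w2 w3 :
    abs_complete v -> 2%:R != 0 :> K ->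
    z1 <> z2 -> z1 <> z3 -> z2 <> z3 -> w1 <> w2 -> w1 <> w3 -> w2 <> w3 ->
    P1_cvg v (fun k => SL2_act (A k) z1) w1 ->
    P1_cvg v (fun k => SL2_act (A k) z2) w2 ->
    P1_cvg v (fun k => SL2_act (A k) z3) w3 ->
  exists T : SL2 K, P1_unif_cvg v (fun k => SL2_act (A k)) (SL2_act T).
Proof.
move=> vcomplete two_neq0 z12 z13 z23 w12 w13 w23 A1 A2 A3.
have [M [N AM]] := SL2_eventually_bounded z12 z13 z23 w12 w13 w23 A1 A2 A3.
(* Dropping finitely many terms makes the sequence bounded. *)
pose A' k := A (k + N)%N.
have A'M k : mxnorm (val (A' k)) <= M by apply: AM; rewrite leq_addl.
have shift z w : P1_cvg v (fun k => SL2_act (A k) z) w ->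
    P1_cvg v (fun k => SL2_act (A' k) z) w.
  by rewrite /P1_cvg -(cvg_shiftn N).
have [S A'S cS] := SL2_eqpm_Cauchy two_neq0
  (SL2_Cauchy_up_to_sign z12 z13 z23
    (shift _ _ A1) (shift _ _ A2) (shift _ _ A3) A'M).
have SM k : mxnorm (val (S k)) <= M.
  apply: le_trans (A'M k); have := A'S k; rewrite /SL2_eqpm => /orP[]/eqP->//.
  by rewrite mxnormN.
have [B SB] := mx_complete vcomplete cS.
have dB := SL2_limit SM SB.
pose T : SL2 K := exist _ B (introT eqP dB); exists T.
have := @P1_unif_cvg_act S T M SM SB; rewrite /P1_unif_cvg => h.
rewrite -(cvg_shiftn N); apply: cvg_trans h; apply: near_eq_cvg; apply: nearW => k.
congr ereal_sup; apply: eq_imagel => z _; congr (chordal v _ _)%:E.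
by apply/esym/SL2_act_eqpm/A'S.
Qed.

End NonarchimedeanField.

Theorem theorem1p12 (R : realType) (p : nat) (p_prime : prime p)
    (K : padicComplex R p) (g : nat -> PSL2 K) (z1 z2 z3 w1 w2 w3 : P1 K)
    (z12 : z1 <> z2) (z13 : z1 <> z3) (z23 : z2 <> z3)
    (w12 : w1 <> w2) (w13 : w1 <> w3) (w23 : w2 <> w3)
    (g1 : P1_cvg (Cp_abs K) (fun n => mobius (g n) z1) w1)
    (g2 : P1_cvg (Cp_abs K) (fun n => mobius (g n) z2) w2)
    (g3 : P1_cvg (Cp_abs K) (fun n => mobius (g n) z3) w3) :
  exists h : PSL2 K,
    P1_unif_cvg (Cp_abs K) (fun n => mobius (g n)) (mobius h) /\
    mobius h z1 = w1 /\ mobius h z2 = w2 /\ mobius h z3 = w3.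
Proof.
have hv := Cp_abs_nonarchimedean K.
have two_neq0 : 2%:R != 0 :> K.
  (* The rationals embed into the field. *)
  rewrite -(rmorph_nat (Qpbar_to_Cp K)) -(rmorph_nat (Qp_to_Qpbar K)).
  by rewrite -(rmorph_nat (rat_to_Qp K)) !fmorph_eq0.
have [T gT] := SL2_cvg_three_points hv (completion_complete (Cp_completion K))
  two_neq0 z12 z13 z23 w12 w13 w23 g1 g2 g3.
have gh : P1_unif_cvg (Cp_abs K) (fun n => mobius (g n)) (mobius (\pi_(PSL2 K) T)%qT).
  by rewrite (funext (mobius_pi T)).
exists (\pi_(PSL2 K) T)%qT; split=> //.
have lim z w := P1_cvg_unique hv (w' := w) (P1_unif_cvg_pointwise hv z gh).
by split; [exact: lim|split; exact: lim].
Qed.
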